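(* Let $X$ be a locally compact space with countable base and let $G\colon X\times X\to[0,\infty]$ be a function such that: (i) for every $y\in X$, the function $G(\cdot,y)$ is lower semicontinuous and $\limsup_{x\to y}G(x,y)=\infty$; (ii) $G$ is continuous outside the diagonal $\Delta$ of $X\times X$ and Borel measurable on $\Delta$; (iii) for every compact $K$ in $X$ there exists a compact $L$ in $X$ such that $G$ is bounded on $(X\setminus L)\times K$. If a set $A\subset X$ satisfies $m_G(A)<\infty$, then $A$ is contained in a $G$-semipolar Borel set.
   Context: $\mathcal M(X)$ is the set of positive Radon measures on $X$; for $\mu\in\mathcal M(X)$, $G\mu(x):=\int G(x,y)\,d\mu(y)$. A Borel set $A\subset X$ is called $G$-semipolar if there is no $\mu\in\mathcal M(X)$, $\mu\neq0$, such that $\mu(X\setminus A)=0$ and $G\mu$ is a continuous real function on $X$. $G$-balls: $B(x,\rho):=\{y\in X: G(x,y)>1/\rho\}$, $x\in X$, $\rho>0$. Intrinsic Hausdorff measure: for $A\subset X$ and $\delta>0$, $$m_G^\delta(A):=\inf\Big\{\sum_{j=1}^\infty\rho_j:\ A\subset\bigcup_{j=1}^\infty B(x_j,\rho_j),\ x_j\in X,\ 0<\rho_j<\delta\Big\},\qquad m_G(A):=\lim_{\delta\to0}m_G^\delta(A)$$ (with $\inf\emptyset=\infty$). *)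

(* Defs.v *)
From HB Require Import structures.
From mathcomp Require Import all_boot all_order all_algebra.
From mathcomp Require Import all_classical all_reals all_analysis.
From mathcomp Require Import measurable_realfun.

Set Implicit Arguments.
Unset Strict Implicit.
Unset Printing Implicit Defensive.

Import Order.TTheory GRing.Theory Num.Theory.
Import numFieldNormedType.Exports.

Local Open Scope classical_set_scope.
Local Open Scope ring_scope.
Local Open Scope ereal_scope.

Notation borelType T := (g_sigma_algebraType (@open T)).

Section potential.
Context {R : realType} {X : ptopologicalType}.
Implicit Types (G : X * X -> \bar R) (mu : {measure set (borelType X) -> \bar R}).

Definition radon mu :=
  (forall K : set X, compact K -> mu K < +oo) /\
  (forall E : set (borelType X), measurable E ->
     mu E = ereal_sup [set mu K | K in
              [set K : set X | compact K /\ K `<=` E]]).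

Definition potential G mu (x : X) : \bar R := \int[mu]_y G (x, y).

(* A measure is a function on all subsets of [X], with unspecified values off
   the Borel sets; hence mu <> 0 is expressed on the whole space. *)
Definition semipolar G (A : set X) :=
  measurable (A : set (borelType X)) /\
  ~ exists mu : {measure set (borelType X) -> \bar R},
      [/\ radon mu, mu [set: X] != 0, mu (~` A) = 0 &
          exists2 f : X -> R, continuous f &
            forall x, potential G mu x = (f x)%:E].

Definition Gball G (x : X) (rho : R) : set X :=
  [set y | (rho^-1)%:E < G (x, y)].

Definition hausdorff_delta G (d : R) (A : set X) : \bar R :=
  ereal_inf [set s | exists (x : nat -> X) (rho : nat -> R),
    [/\ A `<=` \bigcup_j Gball G (x j) (rho j),
        forall j, (0 < rho j < d)%R &
        s = \sum_(0 <= j <oo) (rho j)%:E]].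

Definition hausdorff_measure G (A : set X) : \bar R :=
  lim (hausdorff_delta G d A @[d --> (0 : R)%R^'+]).

End potential.

(* Main.v *)
(* Cover A, for every n, by balls of radii less than 1/n with sum of radii at
   most C, and let B be the intersection over n of the unions of these covers.
   If mu lives on B and G mu is continuous and finite, then for compact K the
   integrals of G truncated at height n on K are lower semicontinuous and
   increase to G mu, so by Dini's theorem the convergence is uniform.  Hence
   mu (K `&` B (x, rho)) <= e * rho for all x and all small rho, and summing
   over the covers gives mu (K `&` B) <= e * C for every e > 0. *)
Require Import Defs.
From HB Require Import structures.
From mathcomp Require Import all_boot all_order all_algebra.
From mathcomp Require Import all_classical all_reals all_analysis.
From mathcomp Require Import measurable_realfun.

Set Implicit Arguments.
Unset Strict Implicit.
Unset Printing Implicit Defensive.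

Import Order.TTheory GRing.Theory Num.Theory.
Import numFieldNormedType.Exports.

Local Open Scope classical_set_scope.
Local Open Scope ring_scope.
Local Open Scope ereal_scope.

(** * Semicontinuity of integrals *)

(** The finite intersections of an enumeration of the basic sets containing [x] decrease and
    eventually lie in any given neighbourhood of [x]. This lets sequences test semicontinuity. *)
Lemma second_countable_nbhs_seq (X : topologicalType) (x : X) :
  @second_countable X ->
  exists2 V : nat -> set X, forall n, nbhs x (V n) &
    forall W, nbhs x W -> \forall n \near \oo, V n `<=` W.
Proof.
move=> [B cB [Bo Bx]]; pose D := [set U | B U /\ U x].
have cD : countable D by apply: sub_countable cB; apply: subset_card_le => U [].
have [D0|/unsquash f] := pfcard_geP cD.
  have [U DU _] : nbhs (filter_from D id) setT by apply: Bx; exact: filterT.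
  by move: DU; rewrite D0.
exists (fun n => \big[setI/setT]_(i < n.+1) f i).
  move=> n; elim/big_ind: _ => [|U W|i _]; [exact: filterT|exact: filterI|].
  have [Bf fx] : D (f i) by exact: funS.
  by rewrite nbhsE; exists (f i) => //; split => //; exact: Bo.
move=> W /Bx[U DU UW].
have [i _ fiU] : (f @` setT) U by exact: surj.
near=> n; rewrite -fiU in UW.
apply: subset_trans UW.
have ni : (i < n.+1)%N by rewrite ltnS; near: n; exact: nbhs_infty_ge.
by rewrite -bigcap_mkord => z /(_ i ni).
Unshelve. all: by end_near. Qed.

Lemma lee_dense (R : realType) (x y : \bar R) :
  (forall r : R, r%:E < x -> r%:E <= y) -> x <= y.
Proof.
case: x => [r| |] xy; last by rewrite leNye.
  apply/lee_subgt0Pr => e e0; rewrite -EFinB; apply: xy.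
  by rewrite lte_fin ltrBlDr ltrDl.
rewrite leye_eq; apply/eqP/eqyP => r _; apply: xy; exact: ltry.
Qed.

(** Fatou's lemma along a sequence tending to [x]; second countability makes sequences
    sufficient. *)
Lemma lower_semicontinuous_integral (R : realType) (X : topologicalType)
    d (T : measurableType d) (mu : {measure set T -> \bar R})
    (h : X -> T -> \bar R) :
  @second_countable X ->
  (forall x y, 0 <= h x y) ->
  (forall x, measurable_fun setT (h x)) ->
  (forall y, lower_semicontinuous (h^~ y)) ->
  lower_semicontinuous (fun x => \int[mu]_y h x y).
Proof.
move=> X2 h0 mh lsch x a axh.
have [V Vx Vsub] := second_countable_nbhs_seq x X2.
(* Otherwise each [V n] contains a point [z n] where the integral is at most [a], and Fatou's lemma
   carries this bound over to [x]. *)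
apply: contrapT => nV.
have /choice[z zP] n : exists z, V n z /\ \int[mu]_y h z y <= a%:E.
  apply: contrapT => nz; apply: nV; exists (V n) => // z Vz.
  by rewrite ltNge; apply/negP => za; apply: nz; exists z.
have : \int[mu]_y h x y <= a%:E.
  apply: (@le_trans _ _ (\int[mu]_y limn_einf (fun n => h (z n) y))).
    apply: ge0_le_integral => //.
    - apply: (emeasurable_fun_cvg (fun n y => einfs (fun k => h (z k) y) n)).
        by move=> n; exact: measurable_fun_einfs.
      by move=> y _; rewrite limn_einf_lim; exact: is_cvg_einfs.
    (* Semicontinuity in the first variable along [z], tested at each real level [b] below
       [h x y]. *)
    - move=> y _; apply: lee_dense => b /lsch[W Wx Wb].
      rewrite limn_einf_lim; apply: lime_ge; first exact: is_cvg_einfs.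
      have [N _ VW] := Vsub _ Wx.
      near=> n; apply: le_ereal_inf_tmp => _ [k /= nk <-].
      apply/ltW/Wb/(VW k); last exact: (zP k).1.
      by rewrite /= (leq_trans _ nk)//; near: n; exact: nbhs_infty_ge.
  apply: (le_trans (fatou mu measurableT _ _)) => //.
  rewrite limn_einf_lim; apply: lime_le; first exact: is_cvg_einfs.
  apply: nearW => n; apply: le_trans (zP n).2; apply: ereal_inf_lbound.
  by exists n => /=.
by rewrite leNgt axh.
Unshelve. all: by end_near. Qed.

(** Makes the off-diagonal set open, so that continuity of the kernel within it is continuity at
    each of its points. *)
Lemma closed_diagonal (X : topologicalType) :
  hausdorff_space X -> closed (@classical_sets.diagonal X).
Proof.
rewrite open_hausdorff => X2; rewrite -openC openE => -[x y] /= /eqP xy.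
have [[U V] /= [/set_mem Ux /set_mem Vy] [oU oV /eqP UV0]] := X2 _ _ xy.
exists (U, V) => /=; first by split; exact: open_nbhs_nbhs.
move=> [a b] [/= Ua Vb] ab; have {}ab : a = b := ab; rewrite -ab in Vb.
have : (U `&` V) a by split.
by rewrite UV0.
Qed.

Lemma measurable_closed_borel (X : ptopologicalType) (F : set X) :
  closed F -> measurable (F : set (borelType X)).
Proof.
move=> cF; rewrite -[F]setCK; apply: measurableC; apply: sub_gen_smallest.
exact: closed_openC.
Qed.

(** * Measurability and truncation of the kernel *)

Section kernel.
Context {R : realType} {X : ptopologicalType} (G : X * X -> \bar R).
Hypothesis X_hausdorff : hausdorff_space X.
Hypothesis G_ge0 : forall p, 0 <= G p.
Hypothesis G_lsc : forall y, lower_semicontinuous (fun x => G (x, y)).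
Hypothesis G_continuous : {within ~` @classical_sets.diagonal X, continuous G}.
Implicit Types K : set X.

Let closed_set1 (x : X) : closed [set x].
Proof. exact/accessible_closed_set1/hausdorff_accessible. Qed.

(** Off the point [x] the set is open, by continuity of [G] away from the diagonal; what remains is
    empty or the closed singleton [[set x]]. *)
Lemma measurable_superlevel_section (x : X) (c : R) :
  measurable ([set y | c%:E < G (x, y)] : set (borelType X)).
Proof.
set S := [set y | _].
have -> : S = (S `&` ~` [set x]) `|` (S `&` [set x]).
  by rewrite -setIUr setUC setUv setIT.
apply: measurableU.
  apply: sub_gen_smallest; rewrite openE => y [Sy yx].
  have Gxy : {for (x, y), continuous G}.
    move: G_continuous; rewrite continuous_open_subspace.
      by apply; rewrite inE => /= xy; exact: yx.
    by rewrite openC; exact: closed_diagonal.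
  have xG : {for y, continuous (fun z => G (x, z))}.
    apply: continuous_comp Gxy.
    by apply: cvg_pair; [exact: cvg_cst|exact: cvg_id].
  apply: filterI.
    exact: (xG _ (open_nbhs_nbhs (conj (@open_ereal_gt_ereal _ c%:E) Sy))).
  apply: open_nbhs_nbhs; split => //; rewrite openC; exact: closed_set1.
have [Sx|Sx] := pselect (S x).
  have -> : S `&` [set x] = [set x] by apply: setIidr => _ ->.
  by apply: measurable_closed_borel; exact: closed_set1.
by have -> : S `&` [set x] = set0
  by apply/disjoints_subset => y Sy /= yx; rewrite yx in Sy.
Qed.

Lemma measurable_kernel_section (x : X) :
  measurable_fun setT ((fun y => G (x, y)) : borelType X -> \bar R).
Proof.
apply: (measurability _ (ErealGenOInfty.measurableE R)).
move=> /= _ [_ [a ->]] <-; apply: measurableI => //.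
by rewrite preimage_itvoy; exact: measurable_superlevel_section.
Qed.

Lemma measurable_Gball (x : X) (rho : R) :
  measurable (Gball G x rho : set (borelType X)).
Proof. exact: measurable_superlevel_section. Qed.

(** The kernel is cut only for [y] in [K], so that the error made in the potential comes from [K]
    alone, where a bound on [G] for [x] far away is available. *)
Definition truncated_kernel K (n : nat) (x : X) (y : borelType X) : \bar R :=
  if y \in K then mine (G (x, y)) n%:R%:E else G (x, y).

Lemma truncated_kernel_ge0 K n x y : 0 <= truncated_kernel K n x y.
Proof.
rewrite /truncated_kernel; case: ifP => _ //.
by rewrite le_min G_ge0 lee_fin ler0n.
Qed.

Lemma truncated_kernel_nondecreasing K x y :
  nondecreasing_seq (fun n => truncated_kernel K n x y).
Proof.
move=> m n mn; rewrite /truncated_kernel; case: ifP => // _.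
by rewrite le_min !ge_min lexx lee_fin ler_nat mn orbT.
Qed.

Lemma truncated_kernel_cvg K x y :
  truncated_kernel K n x y @[n --> \oo] --> G (x, y).
Proof.
rewrite /truncated_kernel; case: (y \in K); last exact: cvg_cst.
have := G_ge0 (x, y); case: (G (x, y)) => [r| |] // r0.
  apply: cvg_near_cst; near=> n; apply/min_idPl; rewrite lee_fin.
  by near: n; exact: nbhs_infty_ger.
apply/cvgeyPge => a; near=> n; rewrite minye lee_fin.
by near: n; exact: nbhs_infty_ger.
Unshelve. all: by end_near. Qed.

Lemma measurable_truncated_kernel K n x :
  compact K -> measurable_fun setT (truncated_kernel K n x).
Proof.
move=> K_compact; apply: measurable_fun_ifT.
- apply: (@measurable_fun_bool _ _ _ _ true).
  rewrite setTI.
  have -> : (fun y : borelType X => y \in K) @^-1` [set true] = K.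
    by apply/seteqP; split=> y /=; [move/set_mem|move/mem_set].
  by apply: measurable_closed_borel; exact: compact_closed.
- by apply: measurable_mine => //; exact: measurable_kernel_section.
- exact: measurable_kernel_section.
Qed.

Lemma lower_semicontinuous_truncated_kernel K n y :
  lower_semicontinuous (fun x => truncated_kernel K n x y).
Proof.
move=> x a; rewrite /truncated_kernel; case: ifP => _; last exact: G_lsc.
rewrite lt_min => /andP[/G_lsc[V Vx VG] an].
by exists V => // z /VG zG; rewrite lt_min zG.
Qed.

End kernel.

(** * Uniform truncation and the mass of small balls *)

Section truncation.
Context {R : realType} {X : ptopologicalType} (G : X * X -> \bar R).
Hypotheses (X_hausdorff : hausdorff_space X)
  (X_countable : @second_countable X).
Hypothesis G_ge0 : forall p, 0 <= G p.
Hypothesis G_lsc : forall y, lower_semicontinuous (fun x => G (x, y)).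
Hypothesis G_continuous : {within ~` @classical_sets.diagonal X, continuous G}.
Hypothesis G_bounded : forall K : set X, compact K ->
  exists2 L : set X, compact L &
    exists M : R, forall x y, (~` L) x -> K y -> G (x, y) <= M%:E.
Context (mu : {measure set (borelType X) -> \bar R}) (f : X -> R) (K : set X).
Hypotheses (f_continuous : continuous f)
  (fE : forall x, potential G mu x = (f x)%:E) (K_compact : compact K).

Let s n x := \int[mu]_y truncated_kernel G K n x y.

Let mtrunc n x : measurable_fun setT (truncated_kernel G K n x) :=
  measurable_truncated_kernel X_hausdorff G_continuous n x K_compact.

Let trunc_ge0 := truncated_kernel_ge0 G_ge0 K.

Let s_cvg x : s n x @[n --> \oo] --> (f x)%:E.
Proof.
rewrite -fE /potential.
have -> : \int[mu]_y G (x, y) =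
    \int[mu]_y limn (fun n => truncated_kernel G K n x y).
  apply: eq_integral => y _; apply/esym/cvg_lim => //.
  exact: truncated_kernel_cvg.
apply: cvg_monotone_convergence => // y _.
exact: truncated_kernel_nondecreasing.
Qed.

Let s_nondecreasing x : nondecreasing_seq (s ^~ x).
Proof.
move=> m n mn; apply: ge0_le_integral => // y _.
exact: truncated_kernel_nondecreasing.
Qed.

Let s_le n x : s n x <= (f x)%:E.
Proof.
rewrite -fE; apply: ge0_le_integral => // [|y _].
  exact: measurable_kernel_section.
by rewrite /truncated_kernel; case: ifP => // _; rewrite ge_min lexx.
Qed.

(* Dini's theorem on a compact set outside of which the truncation is not
   seen, the kernel being bounded there. *)
Lemma uniform_truncated_potential (e : R) : (0 < e)%R ->
  exists n, forall x, (f x - e)%:E < \int[mu]_y truncated_kernel G K n x y.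
Proof.
move=> e0; have [L cL [M GM]] := G_bounded K_compact.
have Lnear : \forall n \near \oo, L `<=` [set x | (f x - e)%:E < s n x].
  (* Near-covering form of compactness: at each point of [L], a neighbourhood and a threshold for
     [n] are to be found jointly. *)
  apply: (compact_near_coveringP _).1 => // x Lx.
  have : \forall n \near \oo, (f x - e)%:E < s n x.
    apply: (s_cvg (open_nbhs_nbhs (conj (@open_ereal_gt_ereal _ _) _))) => /=.
    by rewrite lte_fin ltrBlDr ltrDl.
  case=> N _ /(_ N (leqnn N)) /= xN.
  (* The level [t] leaves room on both sides: near [x], continuity keeps [f - e] below [t] and lower
     semicontinuity keeps [s N] above it. Monotonicity in [n] does the rest. *)
  have [t ft ts] : exists2 t, (f x - e < t)%R & t%:E < s N x.
    have : s N x \is a fin_num.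
      by rewrite ge0_fin_numE ?integral_ge0// (le_lt_trans (s_le N x))// ltry.
    case: (s N x) xN => // r; rewrite lte_fin => /midf_lt[fr rf] _.
    by exists ((f x - e + r) / 2)%R; rewrite ?lte_fin.
  have [V Vx Vs] := lower_semicontinuous_integral (mu := mu) X_countable
    (trunc_ge0 N) (mtrunc N)
    (@lower_semicontinuous_truncated_kernel _ _ _ G_lsc K N) ts.
  near=> z n => /=.
  apply: (@lt_trans _ _ t%:E).
    rewrite lte_fin ltrBlDr; near: z.
    apply: (f_continuous (open_nbhs_nbhs (conj (@open_lt _ _) _))) => /=.
    by rewrite -ltrBlDr.
  apply: (@lt_le_trans _ _ (s N z)); first by apply: Vs; near: z.
  by apply: s_nondecreasing; near: n; exact: nbhs_infty_ge.
(* Taking [n] at least [M] also makes the truncated potential equal to [f x] for [x] outside [L]. *)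
have [n [Ln Mn]] := filter_ex (filterI Lnear (nbhs_infty_ger M)).
exists n => x; have [Lx|nLx] := pselect (L x); first exact: Ln.
rewrite (_ : \int[mu]_y _ = (f x)%:E) ?lte_fin ?ltrBlDr ?ltrDl//.
rewrite -fE; apply: eq_integral => y _; rewrite /truncated_kernel.
case: ifPn => // /set_mem Ky; apply/min_idPl.
by rewrite (le_trans (GM _ _ nLx Ky))// lee_fin.
Unshelve. all: by end_near. Qed.

(* On a small ball the truncation removes from the kernel at least half of
   its lower bound [rho^-1]. *)
Lemma uniform_measure_Gball (e : R) : (0 < e)%R ->
  exists2 d : R, (0 < d)%R & forall x (rho : R), (0 < rho < d)%R ->
    mu (K `&` Gball G x rho) <= e%:E * rho%:E.
Proof.
move=> e0.
have /uniform_truncated_potential[n fn] : (0 < e / 2)%R by rewrite divr_gt0.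
have n0 : (0 < n%:R * 2 + 1 :> R)%R by rewrite ltr_wpDl// mulr_ge0.
(* Radii below this bound satisfy [n <= rho^-1 / 2]; the added 1 keeps the denominator positive when
   [n] is 0. *)
exists (n%:R * 2 + 1)^-1%R; first by rewrite invr_gt0.
move=> x rho /andP[rho0 rhon].
set E := K `&` _.
have mE : measurable (E : set (borelType X)).
  apply: measurableI; last exact: measurable_Gball.
  by apply: measurable_closed_borel; exact: compact_closed.
have c0 : (0 <= rho^-1 / 2)%R by rewrite divr_ge0// invr_ge0 ltW.
have nc : (n%:R <= rho^-1 / 2)%R.
  rewrite ler_pdivlMr// ltW// (@lt_trans _ _ (n%:R * 2 + 1)%R) ?ltrDl//.
  by rewrite -[ltLHS]invrK ltf_pV2 ?posrE ?invr_gt0.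
have m1 : measurable_fun setT (fun y : borelType X => (\1_E y)%:E : \bar R).
  by apply/measurable_EFinP; exact: measurable_indic.
(* Integrates a pointwise bound: on [E] the truncated kernel is at most [n], hence at most
   [rho^-1 / 2], while [G] exceeds [rho^-1]; off [E] it is at most [G]. *)
have sE : s n x + (rho^-1 / 2)%:E * mu E <= (f x)%:E.
  have <- : \int[mu]_y ((rho^-1 / 2)%:E * (\1_E y)%:E) = (rho^-1 / 2)%:E * mu E.
    by rewrite ge0_integralZl// integral_indic// setIT.
  rewrite -ge0_integralD//; last 2 first.
  - by move=> y _; rewrite mule_ge0// lee_fin.
  - exact: measurable_funeM.
  rewrite -fE; apply: ge0_le_integral => //.
  - by move=> y _; rewrite adde_ge0// mule_ge0// lee_fin.
  - by apply: emeasurable_funD => //; exact: measurable_funeM.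
  - exact: measurable_kernel_section.
  move=> y _; rewrite indicE; have [/set_mem[Ky By]|_] := boolP (y \in E).
    rewrite mule1 /truncated_kernel mem_set// (le_trans _ (ltW By))//.
    apply: (@le_trans _ _ (n%:R%:E + (rho^-1 / 2)%:E)).
      by rewrite leeD2r// ge_min lexx orbT.
    by rewrite -EFinD lee_fin [leRHS]splitr lerD2r.
  rewrite mule0 adde0 /truncated_kernel.
  by case: ifP => // _; rewrite ge_min lexx.
(* The finite number [f x - e / 2] is added to both sides; it lies below [s n x], so the previous
   bound applies. *)
have : (rho^-1 / 2)%:E * mu E <= (e / 2)%:E.
  rewrite -(@leeD2lE _ (f x - e / 2)%:E)// -EFinD subrK.
  by apply: le_trans sE; rewrite leeD2r// ltW.
rewrite -invfM lee_pdivrMl ?mulr_gt0// -!EFinM.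
by rewrite -mulrA (mulrC 2%R) divfK ?pnatr_eq0// (mulrC rho).
Qed.

End truncation.

(** * Covers of bounded total radius and semipolarity *)

(** Smaller [d] admits fewer covers, so the infima increase to the limit as [d] decreases to 0. A
    constant above the limit therefore serves for every [d]. *)
Lemma hausdorff_measure_cover (R : realType) (X : ptopologicalType)
    (G : X * X -> \bar R) (A : set X) :
  hausdorff_measure G A < +oo ->
  exists2 C : R, (0 < C)%R & forall d : R, (0 < d)%R ->
    exists (x : nat -> X) (rho : nat -> R),
      [/\ A `<=` \bigcup_j Gball G (x j) (rho j),
          forall j, (0 < rho j < d)%R &
          \sum_(0 <= j <oo) (rho j)%:E <= C%:E].
Proof.
move=> mA.
have delta_ge0 d : 0 <= hausdorff_delta G d A.
  apply: le_ereal_inf_tmp => _ [x [rho [_ rho0 ->]]].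
  by apply: nneseries_ge0 => j _ _; rewrite lee_fin ltW//; case/andP: (rho0 j).
have delta_le d : (0 < d)%R -> hausdorff_delta G d A <= hausdorff_measure G A.
  move=> d0; have /cvg_lim : hausdorff_delta G d A @[d --> (0 : R)%R^'+] -->
      ereal_sup [set hausdorff_delta G d A | d in `]0%R, +oo[].
    apply: nonincreasing_at_right_cvge => // a b _ _ ab.
    apply: ereal_inf_le_tmp => _ [x [rho [Ax rhoa ->]]].
    exists x, rho; split=> // j; have /andP[-> ra] := rhoa j.
    exact: lt_le_trans ra ab.
  rewrite /hausdorff_measure => -> //.
  by apply: ereal_sup_ubound; exists d => //=; rewrite in_itv/= d0.
have fA : hausdorff_measure G A \is a fin_num.
  by rewrite ge0_fin_numE// (le_trans (delta_ge0 1%R)) ?delta_le.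
(* The added 1 puts the constant strictly above every infimum, so that some cover stays below it,
   and makes it positive for the later division by it. *)
exists (fine (hausdorff_measure G A) + 1)%R.
  by rewrite ltr_wpDl// fine_ge0// (le_trans (delta_ge0 1%R)) ?delta_le.
move=> d d0.
have /ereal_inf_lt[_ [x [rho [Ax rhod ->]]] /ltW sC] :
    hausdorff_delta G d A < (fine (hausdorff_measure G A) + 1)%:E.
  by rewrite (le_lt_trans (delta_le _ d0))// EFinD fineK// lteDl// lte01.
by exists x, rho.
Qed.

(* The limit superior is taken over full neighbourhoods of y.  At a
   non-isolated y this agrees, by lower semicontinuity, with the one over
   punctured neighbourhoods; at an isolated y it says G (y, y) = +oo. *)
Theorem theorem1p1 (R : realType) (X : ptopologicalType) (G : X * X -> \bar R)
    (A : set X) :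
  hausdorff_space X ->
  locally_compact [set: X] ->
  @second_countable X ->
  (forall p, 0 <= G p) ->
  (forall y, lower_semicontinuous (fun x => G (x, y)) /\
             limf_esup (fun x => G (x, y)) (nbhs y) = +oo) ->
  {within ~` @classical_sets.diagonal X, continuous G} ->
  measurable_fun (@classical_sets.diagonal X : set (borelType (X * X)%type)) G ->
  (forall K : set X, compact K ->
     exists2 L : set X, compact L &
       exists M : R, forall x y, (~` L) x -> K y -> G (x, y) <= M%:E) ->
  hausdorff_measure G A < +oo ->
  exists2 B : set X, semipolar G B & A `<=` B.
Proof.
move=> X_hausdorff _ X_countable G_ge0 G_lsc G_continuous _ G_bounded mA.
have {}G_lsc y : lower_semicontinuous (fun x => G (x, y)) by have [] := G_lsc y.
have [C C0 cover] := hausdorff_measure_cover mA.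
have dn n : (0 < n.+1%:R^-1 :> R)%R by rewrite invr_gt0.
have /choice[x /choice[rho xrho]] n := cover _ (dn n).
pose B := \bigcap_n \bigcup_j Gball G (x n j) (rho n j).
have mball y r : measurable (Gball G y r : set (borelType X)).
  exact: measurable_Gball.
have mB : measurable (B : set (borelType X)).
  by apply: bigcapT_measurable => n; exact: bigcupT_measurable.
exists B; last by move=> a Aa n _; have [/(_ a Aa)] := xrho n.
split=> // -[mu [[_ mu_reg] mu0 muB [f f_continuous fE]]].
(* By inner regularity, a Radon measure vanishing on all compact sets vanishes on the whole
   space. *)
suff muK K : compact K -> mu K = 0.
  move/eqP: mu0; apply; rewrite mu_reg; last exact: measurableT.
  apply/eqP; rewrite eq_le; apply/andP; split.
    by apply: ge_ereal_sup => _ [K [cK _] <-]; rewrite muK.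
  apply: ereal_sup_ubound; exists set0; last exact: measure0.
  by split; [exact: compact0|].
move=> cK; have mK : measurable (K : set (borelType X)).
  by apply: measurable_closed_borel; exact: compact_closed.
(* The part of [K] outside [B] is null because [mu] lives on [B]; only the part inside [B]
   remains. *)
apply/eqP; rewrite -measure_le0 (measureDI mu mK mB).
rewrite [X in X + _](_ : _ = 0) ?add0e; last first.
  apply/eqP; rewrite -measure_le0 -muB; apply: le_measure => [||y []//].
    by rewrite inE; exact: measurableD.
  by rewrite inE; exact: measurableC.
apply/lee_addgt0Pr => e e0; rewrite add0e.
(* The tolerance [e / C] per unit of radius turns the total radius, at most [C], into a total mass
   of at most [e]. *)
have [d d0 mu_ball] := uniform_measure_Gball X_hausdorff X_countable G_ge0 G_lsc
  G_continuous G_bounded f_continuous fE cK (divr_gt0 e0 C0).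
(* A single cover suffices, fine enough that all its radii are below [d]. *)
have [n nd] : exists n, (n.+1%:R^-1 < d)%R.
  have [n] := filter_ex (near_infty_natSinv_lt (PosNum d0)).
  by exists n.
have [_ rhon sC] := xrho n.
have KBsub : K `&` B `<=` \bigcup_j (K `&` Gball G (x n j) (rho n j)).
  by move=> y [Ky /(_ n Logic.I)[j _ By]]; exists j.
apply: (le_trans (measure_sigma_subadditive mu _ _ KBsub)).
- by move=> j; exact: measurableI.
- exact: measurableI.
apply: (@le_trans _ _ (\sum_(0 <= j <oo) ((e / C)%:E * (rho n j)%:E))).
  apply: lee_nneseries => // j _; apply: mu_ball.
  by have /andP[-> /lt_trans] := rhon j; apply.
rewrite nneseriesZl; last first.
  by move=> j _; have /andP[/ltW] := rhon j; rewrite lee_fin.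
apply: (@le_trans _ _ ((e / C)%:E * C%:E)).
  by rewrite lee_wpmul2l// lee_fin divr_ge0 ?ltW.
by rewrite -EFinM divfK// gt_eqF.
Qed.
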